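(* Let $n$ mobile agents $1,\dots,n$ be placed on the real line at positions $a_1<a_2<\dots<a_n$ (given in this order), agent $i$ having initial energy $e(i)\ge 0$. The convergecast problem — deciding whether there is a schedule after which some agent holds the initial information of every agent — can be solved in $O(n)$ time.
   Context: Model: agents move continuously along the line (they may stop at any point), spending energy equal to the distance travelled; an agent can only move while it has energy left (energy never becomes negative). When two agents meet at the same point, one of them may transfer any portion of its current energy to the other, and they exchange all information they currently hold (after the meeting each holds the union). Initially each agent holds only its own initial information. A centralized scheduler with full knowledge of the instance decides all moves. *)

(* Defs.v *)
From mathcomp Require Import all_boot all_order all_algebra.
From mathcomp Require Import reals.

Set Implicit Arguments.
Unset Strict Implicit.
Unset Printing Implicit Defensive.

Import Order.TTheory GRing.Theory Num.Theory.
Local Open Scope ring_scope.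

(** * Mobile agents on the line *)

Section Agents.
Variables (R : realType) (n : nat).

(* [known s i] is the set of agents whose initial information [i] holds. *)
Record state := State {
  pos : 'I_n -> R;
  energy : 'I_n -> R;
  known : 'I_n -> {set 'I_n} }.

(* A schedule serialises the motion: a continuous trajectory is cut at its
   turning points and at its meetings into straight moves, and moves made
   simultaneously by different agents are listed one after the other. *)
Inductive action :=
  | Move (i : 'I_n) (x : R)         (* [i] walks straight to the point [x] *)
  | Meet (i j : 'I_n) (t : R).      (* [i] gives energy [t] to [j] *)

Definition enabled (s : state) (m : action) : bool :=
  match m with
  | Move i x => `|x - pos s i| <= energy s i
  | Meet i j t => [&& i != j, pos s i == pos s j, 0 <= t & t <= energy s i]
  end.

Definition perform (s : state) (m : action) : state :=
  match m with
  | Move i x =>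
      State [eta pos s with i |-> x]
            [eta energy s with i |-> energy s i - `|x - pos s i|]
            (known s)
  | Meet i j t =>
      State (pos s)
            [eta energy s with i |-> energy s i - t, j |-> energy s j + t]
            [eta known s with i |-> known s i :|: known s j,
                              j |-> known s i :|: known s j]
  end.

Fixpoint feasible (s : state) (sched : seq action) : bool :=
  if sched is m :: sched' then enabled s m && feasible (perform s m) sched'
  else true.

Definition initial_state (a e : 'I_n -> R) : state :=
  State a e (fun i => [set i]).

Definition convergecast (a e : 'I_n -> R) : Prop :=
  exists2 sched : seq action,
    feasible (initial_state a e) sched &
    exists i, known (foldl perform (initial_state a e) sched) i = [set: 'I_n].

End Agents.

(** * Real random access machine, at unit cost *)

(* The machine has index registers [I], holding naturals, real registers [X],
   and a real memory [M] addressed through index registers.  There is no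
   conversion from reals to naturals (no floor), and the constants of a
   program are integers. *)

Inductive arith := Add | Sub | Mul | Div.

Inductive instr :=
  | Halt of bool
  | Jump of nat
  | JumpIdxLe of nat & nat & nat           (* i j l: if I[i] <= I[j] goto l *)
  | JumpRealLe of nat & nat & nat          (* x y l: if X[x] <= X[y] goto l *)
  | IdxConst of nat & nat                  (* d k: I[d] := k *)
  | IdxAdd of nat & nat & nat              (* d i j: I[d] := I[i] + I[j] *)
  | IdxSub of nat & nat & nat              (* same, truncated subtraction *)
  | RealConst of nat & int                 (* d z: X[d] := z *)
  | RealOp of arith & nat & nat & nat      (* o d x y: X[d] := X[x] o X[y] *)
  | Fetch of nat & nat                     (* d i: X[d] := M[I[i]] *)
  | Store of nat & nat.                    (* i x: M[I[i]] := X[x] *)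

Definition program := seq instr.

Section Machine.
Variable R : realType.

Record machine := Machine {
  pc : nat;
  idx : nat -> nat;
  reg : nat -> R;
  mem : nat -> R }.

(* Division by zero yields zero. *)
Definition arith_eval (o : arith) (x y : R) : R :=
  match o with
  | Add => x + y
  | Sub => x - y
  | Mul => x * y
  | Div => x / y
  end.

Definition goto (s : machine) (l : nat) : machine :=
  Machine l (idx s) (reg s) (mem s).
Definition set_idx (s : machine) (d k : nat) : machine :=
  Machine (pc s).+1 [eta idx s with d |-> k] (reg s) (mem s).
Definition set_reg (s : machine) (d : nat) (x : R) : machine :=
  Machine (pc s).+1 (idx s) [eta reg s with d |-> x] (mem s).
Definition set_mem (s : machine) (k : nat) (x : R) : machine :=
  Machine (pc s).+1 (idx s) (reg s) [eta mem s with k |-> x].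

Definition exec (s : machine) (c : instr) : machine + bool :=
  match c with
  | Halt b => inr b
  | Jump l => inl (goto s l)
  | JumpIdxLe i j l =>
      inl (goto s (if (idx s i <= idx s j)%N then l else (pc s).+1))
  | JumpRealLe x y l =>
      inl (goto s (if reg s x <= reg s y then l else (pc s).+1))
  | IdxConst d k => inl (set_idx s d k)
  | IdxAdd d i j => inl (set_idx s d (idx s i + idx s j)%N)
  | IdxSub d i j => inl (set_idx s d (idx s i - idx s j)%N)
  | RealConst d z => inl (set_reg s d z%:~R)
  | RealOp o d x y => inl (set_reg s d (arith_eval o (reg s x) (reg s y)))
  | Fetch d i => inl (set_reg s d (mem s (idx s i)))
  | Store i x => inl (set_mem s (idx s i) (reg s x))
  end.

(* [run p t s = Some b] iff [p] started in [s] halts with answer [b] after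
   executing at most [t] instructions, the final [Halt] included; leaving the
   program text is not halting. *)
Fixpoint run (p : program) (t : nat) (s : machine) : option bool :=
  if t is t'.+1 then
    if onth p (pc s) is Some c then
      match exec s c with
      | inl s' => run p t' s'
      | inr b => Some b
      end
    else None
  else None.

(* [n] in the index register 0, [M] starting with [input], zeros elsewhere. *)
Definition start_machine (n : nat) (input : seq R) : machine :=
  Machine 0 [eta (fun=> 0%N) with 0%N |-> n] (fun=> 0) (nth 0 input).

(* An instance is stored as a_1, ..., a_n, e_1, ..., e_n. *)
Definition instance_machine (n : nat) (a e : 'I_n -> R) : machine :=
  start_machine n (codom a ++ codom e).

End Machine.

(* Main.v *)
Require Import Defs.
From mathcomp Require Import all_boot all_order all_algebra.
From mathcomp Require Import reals.
From mathcomp Require Import ring lra zify.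

Set Implicit Arguments.
Unset Strict Implicit.
Unset Printing Implicit Defensive.

Import Order.TTheory GRing.Theory Num.Theory.
Local Open Scope ring_scope.

(** Let [L i] be the largest amount of energy with which the information of the
    agents [1..i] can be brought to [a_i] by these agents alone; when negative,
    [- L i] is the least amount that must be imported from the right.  Then
    [L (i+1)] is obtained from [L i] by paying for the segment of length [d]
    between the two agents: once if [d <= L i], twice on the part that is not
    covered by a nonnegative [L i], and twice everywhere if [L i < 0], since the
    information must then be fetched from the right.  With [R i] defined
    symmetrically, a convergecast exists iff [L i + R (i+1)] is at least the
    length of some segment [i], which two linear passes decide.

    For the necessity, the net energy that a schedule carries rightwards past a
    point left of the final meeting is at most the budget available there: on an
    interval containing no turning point, the information crosses it rightwards,
    and a negative outflow at its right end forces a leftward crossing as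
    well. *)

(** * Budgets *)

Ltac split_if := repeat match goal with
  |- context [if @Order.le _ _ ?x ?y then _ else _] => case: (leP x y) => ? end.

Section Cross.
Variable R : realType.
Implicit Types d L : R.

Definition cross d L : R :=
  if d <= L then L - d else if 0 <= L then 2 * (L - d) else L - 2 * d.

Lemma cross_mono d L1 L2 : 0 <= d -> L1 <= L2 -> cross d L1 <= cross d L2.
Proof. by rewrite /cross => d0 L12; split_if; lra. Qed.

Lemma crossD d1 d2 L : 0 <= d1 -> 0 <= d2 ->
  cross d2 (cross d1 L) = cross (d1 + d2) L.
Proof. rewrite {2 3}/cross => ? ?; split_if; rewrite /cross; split_if; lra. Qed.

Lemma cross_ge d L : 0 <= d -> L - 2 * d <= cross d L.
Proof. by rewrite /cross => ?; split_if; lra. Qed.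

End Cross.

(** Makes the number of turning points a decreasing measure: a turning point that splits an open
    interval lies in neither open half. *)
Lemma count_lt (T : eqType) (p q : pred T) (s : seq T) x :
  subpred p q -> x \in s -> q x -> ~~ p x -> (count p s < count q s)%N.
Proof.
move=> pq xs qx px; have := count_predUI p (fun y => q y && ~~ p y) s.
rewrite (eq_count (a1 := predU _ _) (a2 := q)); last first.
  by move=> y; rewrite /=; move: (introT implyP (pq y)); case: (p y); case: (q y).
rewrite (eq_count (a1 := predI p _) (a2 := pred0)); last first.
  by move=> y; rewrite /=; case: (p y); rewrite ?andbF.
rewrite count_pred0 addn0 => ->; rewrite -[ltnLHS]addn0 ltn_add2l -has_count.
by apply/hasP; exists x; rewrite //= qx px.
Qed.

Section Budget.
Variables (R : realType) (n : nat) (a e : 'I_n -> R) (g : nat -> 'I_n).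

(** The enumeration [g] serves both directions: increasing order gives the budgets from the left,
    decreasing order those from the right. *)
Fixpoint budget j : R :=
  if j is j'.+1 then cross `|a (g j) - a (g j')| (budget j') + e (g j)
  else e (g 0%N).

End Budget.

(** * Necessity *)

Section Flux.
Variables (R : realType) (n : nat).
Implicit Types (s : state R n) (sched : seq (action R n)) (P Q : pred R).

Notation after s sched := (foldl (@perform R n) s sched).

(** The weight [f] is left open so that one total covers distance, distance on one side of a point
    and progress inside an interval; relations between weights then pass to totals. *)
Fixpoint travel (f : R -> R -> R) s sched : R :=
  if sched is m :: sched' then
    (if m is Move i x then f (pos s i) x else 0) + travel f (perform s m) sched'
  else 0.

Definition stock P s : R := \sum_(i | P (pos s i)) energy s i.

Lemma travel_le (f1 f2 : R -> R -> R) s sched :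
  (forall p x, f1 p x <= f2 p x) -> travel f1 s sched <= travel f2 s sched.
Proof.
move=> le12; elim: sched s => [|m sched IH] s //=.
by apply: lerD => //; case: m.
Qed.

Lemma travelD (f1 f2 : R -> R -> R) s sched :
  travel (fun p x => f1 p x + f2 p x) s sched =
  travel f1 s sched + travel f2 s sched.
Proof.
elim: sched s => [|m sched IH] s /=; first by rewrite addr0.
by rewrite IH; case: m => *; ring.
Qed.

Lemma travel0 s sched : travel (fun _ _ => 0) s sched = 0.
Proof. by elim: sched s => //= m sched IH s; rewrite IH; case: m; rewrite addr0. Qed.

Lemma travel_ge0 (f : R -> R -> R) s sched :
  (forall p x, 0 <= f p x) -> 0 <= travel f s sched.
Proof. by move=> f0; rewrite -(travel0 s sched); apply: travel_le. Qed.

Lemma stock_move P s i x :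
  stock P (perform s (Move i x)) =
  stock P s - (if P (pos s i) then energy s i else 0)
  + (if P x then energy s i - `|x - pos s i| else 0).
Proof.
rewrite /stock !(big_mkcond (fun k => P _)) /=.
rewrite (bigD1 i) //= [in RHS](bigD1 i) //= !eqxx.
rewrite (eq_bigr (fun k => if P (pos s k) then energy s k else 0)).
  by ring.
by move=> k /negbTE ->.
Qed.

(** The partners share a position, so [P] counts both or neither and the transfer cancels. *)
Lemma stock_meet P s i j t : enabled s (Meet i j t) ->
  stock P (perform s (Meet i j t)) = stock P s.
Proof.
case/and4P=> ij /eqP pij _ _.
rewrite /stock !(big_mkcond (fun k => P _)) /=.
have ji : j != i by rewrite eq_sym.
rewrite (bigD1 i) // (bigD1 j) //= [in RHS](bigD1 i) // [in RHS](bigD1 j) //=.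
rewrite !eqxx (negbTE ji) pij.
rewrite (eq_bigr (fun k => if P (pos s k) then energy s k else 0)).
  by case: ifP => _ //; ring.
by move=> k /andP[/negbTE -> /negbTE ->].
Qed.

Lemma energy_perform_ge0 s m : (forall i, 0 <= energy s i) -> enabled s m ->
  forall i, 0 <= energy (perform s m) i.
Proof.
move=> s0; case: m => [i x|i j t] /=; first by move=> le_e k; case: ifP; rewrite ?subr_ge0.
case/and4P=> _ _ t0 le_e k; case: ifP => _; first by rewrite subr_ge0.
by case: ifP => _ //; rewrite addr_ge0.
Qed.

Lemma energy_after_ge0 s sched : (forall i, 0 <= energy s i) ->
  feasible s sched -> forall i, 0 <= energy (after s sched) i.
Proof.
elim: sched s => [|m sched IH] s //= s0 /andP[en fe].
by apply: IH => //; apply: energy_perform_ge0.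
Qed.

Lemma stock_total s sched : feasible s sched ->
  stock predT s =
  stock predT (after s sched) + travel (fun p x => `|x - p|) s sched.
Proof.
elim: sched s => [|m sched IH] s /=; first by rewrite addr0.
case/andP=> en /IH; case: m en => [i x|i j t] en.
  by rewrite stock_move /=; lra.
by rewrite stock_meet //; lra.
Qed.

Lemma stock_le P Q s : (forall i, 0 <= energy s i) ->
  (forall i, P (pos s i) -> Q (pos s i)) -> stock P s <= stock Q s.
Proof.
move=> s0 PQ; rewrite /stock big_mkcond [leRHS]big_mkcond /=.
apply: ler_sum => i _; case: ifP => [/PQ -> //|_]; by case: ifP.
Qed.

(** * Energy flow across a point and progress of information *)

Section Axis.
(* [v] is the identity or the reflection of the line. *)
Variable v : R -> R.
Hypothesis v_iso : forall x y, `|v x - v y| = `|x - y|.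

Definition below y (p x : R) : R := `|Num.min (v x) y - Num.min (v p) y|.
(* [up z y p x] is the rightward progress of the move from [p] to [x] inside the
   interval from [z] to [y]; [up z y x p] is its leftward progress. *)
Definition span z y (u : R) : R := Num.min u y - Num.min u z.
Definition up z y p x : R := Num.max 0 (span z y (v x) - span z y (v p)).

Lemma span_mono z y u w : z <= y -> u <= w -> span z y u <= span z y w.
Proof.
rewrite /span => zy uw.
case: (leP u z); case: (leP w z); case: (leP u y); case: (leP w y); lra.
Qed.

Lemma up_down z y p x :
  up z y p x + up z y x p = `|span z y (v x) - span z y (v p)|.
Proof.
rewrite /up; move: (span z y (v x)) (span z y (v p)) => b c.
have [bc|/ltW cb] := leP b c.
  by rewrite max_l ?subr_le0 // max_r ?subr_ge0 // ler0_norm ?subr_le0 //; ring.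
by rewrite max_r ?subr_ge0 // max_l ?subr_le0 // ger0_norm ?subr_ge0 // addr0.
Qed.

(** [Num.min u y] is [Num.min u z] plus [span z y u], and all three are nondecreasing in [u], so
    their variations over a move have one sign and the absolute values add. *)
Lemma below_split z y p x : z <= y ->
  below y p x = below z p x + (up z y p x + up z y x p).
Proof.
move=> zy.
rewrite up_down.
have min_mono (t u w : R) : u <= w -> Num.min u t <= Num.min w t.
  by move=> uw; case: (leP u t); case: (leP w t); lra.
rewrite /below; have [px|/ltW px] := leP (v p) (v x).
  rewrite !ger0_norm ?subr_ge0 ?min_mono ?span_mono //; rewrite /span; ring.
rewrite !ler0_norm ?subr_le0 ?min_mono ?span_mono //; rewrite /span; ring.
Qed.

Lemma up_ge0 z y p x : 0 <= up z y p x.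
Proof. by rewrite le_max lexx. Qed.

(* By conservation, the net energy carried across [y] to the right, where [P]
   selects the closed or the open half-line on the left of [y]. *)
Definition outflow P y s sched : R :=
  stock P s - stock P (after s sched) - travel (below y) s sched.
Notation outflow_lt y := (outflow (fun p => v p < y) y).
Notation outflow_le y := (outflow (fun p => v p <= y) y).

(** A move raises the largest [span] among the holders by at most its own [up]; a meeting passes
    information on without displacing it. *)
Lemma info_up (k : 'I_n) z y s sched c : feasible s sched ->
  (forall h, k \in known s h -> span z y (v (pos s h)) <= c) ->
  forall h, k \in known (after s sched) h ->
  span z y (v (pos (after s sched) h)) <= c + travel (up z y) s sched.
Proof.
elim: sched s c => [|m sched IH] s c /=; first by rewrite addr0.
case/andP=> en fe cP h hk.
have := IH (perform s m) (c + if m is Move i x then up z y (pos s i) x else 0) fe _ h hk.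
rewrite -addrA; apply=> {h hk} h; case: m en fe => [i x|i j t] /= en _.
  have := up_ge0 z y (pos s i) x.
  have : span z y (v x) - span z y (v (pos s i)) <= up z y (pos s i) x.
    by rewrite le_max lexx orbT.
  case: eqP => [-> | _] h1 h2 /cP; lra.
case/and4P: en => _ /eqP pij _ _; rewrite addr0.
case: eqP => [->|_]; first by rewrite inE => /orP[] /cP //; rewrite pij.
by case: eqP => [->|_]; [rewrite inE => /orP[] /cP //; rewrite pij | apply: cP].
Qed.

Definition targets sched :=
  pmap (fun m : action R n => if m is Move _ x then Some (v x) else None) sched.

(** Only a move from [y] or beyond to a point before [y] can lower the outflow at [y]. With no
    target strictly inside, it ends at or before [z], hence traverses the whole interval. *)
Lemma left_crossing z y s sched : z <= y -> (forall i, 0 <= energy s i) ->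
  feasible s sched -> (forall x, x \in targets sched -> ~~ (z < x < y)) ->
  0 <= outflow_lt y s sched \/ y - z <= travel (fun p x => up z y x p) s sched.
Proof.
rewrite /outflow => zy; elim: sched s => [|m sched IH] s s0 /=; first by left; lra.
case/andP=> en fe tg; have s0' := energy_perform_ge0 s0 en.
have {IH} [x xt|h|h] := IH (perform s m) s0' fe.
- by apply: tg; case: m en fe s0' => [i x'|i j t] //= *; rewrite inE xt orbT.
- case: m en fe tg s0' h => [i x|i j t] en fe tg s0'; last by rewrite stock_meet //; cbv beta iota => h; left; lra.
  rewrite stock_move; cbv beta iota; set p := pos s i.
  have [yp|py] := leP y (v p); have [yx|xy] := leP y (v x); move=> h.
  + have -> : below y p x = 0 by rewrite /below !min_r // subrr normr0.
    by left; lra.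
  + right; have xz : v x <= z.
      by rewrite leNgt; apply/negP => zx; move: (tg (v x)); rewrite inE eqxx zx xy; move/(_ isT).
    have -> : up z y x p = y - z.
      rewrite /up /span (min_r yp) (min_r (le_trans zy yp)) (min_l (ltW xy)) (min_l xz).
      by rewrite subrr subr0 max_r // subr_ge0.
    have := @travel_ge0 (fun p x => up z y x p) (perform s (Move i x)) sched (fun p x => up_ge0 z y x p).
    by move=> /=; lra.
  (* The energy exported is what is left on reaching [y], nonnegative because the longer walk to [x]
     is affordable. *)
  + left; have -> : below y p x = y - v p.
      rewrite /below min_r // min_l ?(ltW py) // ger0_norm // subr_ge0; exact: ltW.
    move: en => /= en; rewrite -v_iso -/p in en; have := ler_norm (v x - v p).
    lra.
  + left; have -> : below y p x = `|x - p|.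
      by rewrite /below !min_l ?(ltW py) ?(ltW xy).
    lra.
- by right; apply: le_trans h _; rewrite lerDr; case: (m) => // *; apply: up_ge0.
Qed.

(* Induction on the number of turning points between [z] and [y]; [cross] is
   additive in the length, so the interval can be split at any of them. *)
Lemma outflow_cross (k h : 'I_n) z y s sched :
  z < y -> (forall i, 0 <= energy s i) -> feasible s sched ->
  (forall j, k \in known s j -> v (pos s j) <= z) ->
  k \in known (after s sched) h -> y <= v (pos (after s sched) h) ->
  stock (fun p => v p < y) s <= stock (fun p => v p <= z) s ->
  outflow_lt y s sched <= cross (y - z) (outflow_le z s sched).
Proof.
move=> + s0 fe + kh; have f0 := energy_after_ge0 s0 fe.
have [N] := ubnP (count (fun x => z < x < y) (targets sched)).
elim: N z y => // N IH z y ltN zy kz yh st.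
have [/hasP[c ct /andP[zc cy]]|/hasPn tg] := boolP (has (fun x => z < x < y) (targets sched)).
  have le_cz : outflow_lt c s sched <= cross (c - z) (outflow_le z s sched).
    apply: IH => //.
    - apply: leq_trans (ltN : (_ <= N)%N); apply: count_lt ct _ _ => [u||] /=; lra.
    - lra.
    - apply: le_trans st; apply: stock_le => // i; lra.
  have le_yc : outflow_lt y s sched <= cross (y - c) (outflow_le c s sched).
    apply: IH => //.
    - apply: leq_trans (ltN : (_ <= N)%N); apply: count_lt ct _ _ => [u||] /=; lra.
    - move=> j /kz; lra.
    - apply: le_trans st _; apply: stock_le => // i; lra.
  apply: le_trans le_yc _.
  have -> : y - z = (c - z) + (y - c) by ring.
  rewrite -(crossD (d1 := c - z)) ?subr_ge0 ?(ltW zc) ?(ltW cy) //.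
  apply: cross_mono; first lra.
  (* From the open to the closed half-line at [c]: by [st] no initial energy lies at [c], and the
     final stock can only grow. *)
  apply: le_trans le_cz; rewrite /outflow.
  have : stock (fun p => v p <= c) s <= stock (fun p => v p < c) s.
    apply: le_trans (le_trans st _); apply: stock_le => // i; lra.
  have : stock (fun p => v p < c) (after s sched) <= stock (fun p => v p <= c) (after s sched).
    by apply: stock_le => // i; lra.
  lra.
have zy' := ltW zy.
have trav : travel (below y) s sched = travel (below z) s sched +
    (travel (up z y) s sched + travel (fun p x => up z y x p) s sched).
  rewrite -!travelD; apply/eqP; rewrite eq_le.
  by apply/andP; split; apply: travel_le => p x; rewrite (below_split _ _ zy').
have upd : y - z <= travel (up z y) s sched.
  have kz0 j : k \in known s j -> span z y (v (pos s j)) <= 0.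
    by move=> /kz jz; rewrite /span !min_l ?subrr //; lra.
  have := info_up fe kz0 kh; rewrite add0r /span min_r // min_r //.
  exact: le_trans zy' yh.
have down0 : 0 <= travel (fun p x => up z y x p) s sched.
  by apply: travel_ge0 => p x; apply: up_ge0.
have le_flow : outflow_lt y s sched <= outflow_le z s sched -
    (travel (up z y) s sched + travel (fun p x => up z y x p) s sched).
  rewrite /outflow.
  have : stock (fun p => v p <= z) (after s sched) <= stock (fun p => v p < y) (after s sched).
    by apply: stock_le => // i; lra.
  lra.
(* A nonnegative outflow at [y] forces at least [y - z] at [z], the case where [cross] pays once.
   Otherwise both directions are traversed, which costs the worst case of [cross_ge]. *)
have [f|f] := left_crossing zy' s0 fe tg.
  by rewrite /cross; split_if; lra.
by apply: le_trans (cross_ge _ _); lra.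
Qed.

(** Induction along [g], tracing the information of [g 0]: [outflow_cross] handles each segment, and
    closing the half-line at the next agent adds its initial energy. For [j = 0] no segment is
    crossed, so the place of [h] is left free. *)
Lemma outflow_budget (a e : 'I_n -> R) (g : nat -> 'I_n) (h : 'I_n) m sched :
  let s := initial_state a e in
  (forall i, 0 <= e i) -> feasible s sched ->
  known (after s sched) h = [set: 'I_n] ->
  (forall i, exists2 j, (j <= m)%N & g j = i) ->
  (forall i j, (i < j <= m)%N -> v (a (g i)) < v (a (g j))) ->
  forall j, (j <= m)%N ->
  ((0 < j)%N -> v (a (g j)) <= v (pos (after s sched) h)) ->
  outflow_le (v (a (g j))) s sched <= budget a e g j.
Proof.
move=> s e0 fe kh gs gm.
have glt i j : (i <= m)%N -> (j <= m)%N -> (v (a (g i)) < v (a (g j))) = (i < j)%N.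
  move=> im jm; case: (ltngtP i j) => [ij|ji|->]; last exact: ltxx.
    by rewrite gm // ij.
  by apply/negbTE; rewrite -leNgt ltW // gm // ji.
have gle i j : (i <= m)%N -> (j <= m)%N -> (v (a (g i)) <= v (a (g j))) = (i <= j)%N.
  by move=> im jm; rewrite leNgt glt // -leqNgt.
have f0 := energy_after_ge0 (s := s) e0 fe.
have stock_in j : (j <= m)%N -> stock (fun p => v p <= v (a (g j))) s =
    e (g j) + stock (fun p => v p < v (a (g j))) s.
  move=> jm; rewrite /stock /= (bigD1 (g j)) //=; congr (_ + _).
  apply: eq_bigl => i; have [l lm <-] := gs i.
  rewrite gle // glt // ltn_neqAle andbC; congr (~~ _ && _).
  by apply/eqP/eqP => [/(congr1 (v \o a)) /= /eqP|-> //]; rewrite eq_le !gle // -eqn_leq => /eqP.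
elim=> [|j IH] jm jX.
  rewrite /outflow stock_in // [X in e _ + X]big_pred0 ?addr0 /=; last first.
    by move=> i; have [l lm <-] := gs i; rewrite glt.
  have : 0 <= stock (fun p => v p <= v (a (g 0%N))) (after s sched) by apply: sumr_ge0.
  have := @travel_ge0 (below (v (a (g 0%N)))) s sched (fun p x => normr_ge0 _).
  lra.
have lt_uu : v (a (g j)) < v (a (g j.+1)) by rewrite glt ?ltnS // ltnW.
have ujX : v (a (g j.+1)) <= v (pos (after s sched) h) by apply: jX.
have {}IH := IH (ltnW jm) (fun _ => le_trans (ltW lt_uu) ujX).
have le_st : stock (fun p => v p < v (a (g j.+1))) s <= stock (fun p => v p <= v (a (g j))) s.
  apply: stock_le => // i /=; have [l lm <-] := gs i.
  by rewrite glt // gle // ltnW.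
have kg i : g 0%N \in known s i -> v (pos s i) <= v (a (g j)).
  by rewrite inE => /eqP <- /=; rewrite gle // ltnW.
have kX : g 0%N \in known (after s sched) h by rewrite kh inE.
have := outflow_cross (s := s) lt_uu e0 fe kg kX ujX le_st.
have -> : v (a (g j.+1)) - v (a (g j)) = `|a (g j.+1) - a (g j)|.
  by rewrite -v_iso ger0_norm // subr_ge0 ltW.
move=> /le_trans /(_ (cross_mono (normr_ge0 _) IH)) /=.
rewrite /outflow stock_in //.
have : stock (fun p => v p < v (a (g j.+1))) (after s sched) <=
    stock (fun p => v p <= v (a (g j.+1))) (after s sched).
  by apply: stock_le => // i; lra.
lra.
Qed.
End Axis.

(** * Confronting the flows from the left and from the right *)

Lemma span_opp (z y u : R) : z <= y -> span (- y) (- z) (- u) = (y - z) - span z y u.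
Proof.
rewrite /span -!oppr_max; have := addr_max_min u z; have := addr_max_min u y; lra.
Qed.

(** The part of a move beyond [y] is written as [below] after reflection, so that the outer terms
    match the two outflows. *)
Lemma dist_split (z y p x : R) : z <= y ->
  `|x - p| = below id z p x + below -%R (- y) p x + (up id z y p x + up id z y x p).
Proof.
move=> zy; rewrite up_down /below -!oppr_max.
have min_mono (t u w : R) : u <= w -> Num.min u t <= Num.min w t.
  by move=> uw; case: (leP u t); case: (leP w t); lra.
have max_mono (t u w : R) : u <= w -> - Num.max w t <= - Num.max u t.
  by move=> uw; case: (leP u t); case: (leP w t); lra.
have := addr_max_min x y; have := addr_max_min p y.
have [px|/ltW px] := leP p x.
  rewrite [`|- _ - - _|]ler0_norm ?subr_le0 ?max_mono //.
  rewrite !ger0_norm ?subr_ge0 ?min_mono ?span_mono //.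
  rewrite /span; lra.
rewrite [`|- _ - - _|]ger0_norm ?subr_ge0 ?max_mono //.
rewrite !ler0_norm ?subr_le0 ?min_mono ?span_mono //.
rewrite /span; lra.
Qed.

(** On the segment of the final position, conservation of energy makes the two outflows pay for all
    travel inside it. Information from both ends reaches that position, so this travel is at least
    the length. *)
Lemma convergecast_gathers m (a e : 'I_n -> R) (g g' : nat -> 'I_n) :
  (forall i, exists2 j, (j <= m.+1)%N & g j = i) ->
  (forall j, (j <= m.+1)%N -> g' j = g (m.+1 - j)%N) ->
  (forall i j, (i < j <= m.+1)%N -> a (g i) < a (g j)) ->
  (forall i, 0 <= e i) -> convergecast a e ->
  exists2 i, (i <= m)%N &
    `|a (g i.+1) - a (g i)| <= budget a e g i + budget a e g' (m - i).
Proof.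
move=> gs gg' gm e0 [sched fe [h kh]].
set s := initial_state a e in fe kh; set X := pos (after s sched) h.
(* The segment containing [X]; a position outside all agents is assigned to the first or last
   segment. *)
have ex_i : exists i, (i == m) || (X <= a (g i.+1)) by exists m; rewrite eqxx.
case: (ex_minnP ex_i) => i iX i_min.
have im : (i <= m)%N by apply: i_min; rewrite eqxx.
exists i => //.
have lefti : (0 < i)%N -> a (g i) <= X.
  case: (i) im i_min => // i' i'm i_min _.
  have := contra (i_min i'); rewrite ltnn => /(_ isT).
  by rewrite negb_or -ltNge => /andP[_ /ltW].
have righti : (i < m)%N -> X <= a (g i.+1).
  by case/orP: iX => [/eqP ->|//]; rewrite ltnn.
have iso_id (x y : R) : `|id x - id y| = `|x - y| by [].
have iso_opp (x y : R) : `|- x - - y| = `|x - y|.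
  by rewrite -opprD normrN.
have gs' k : exists2 j, (j <= m.+1)%N & g' j = k.
  have [j jm <-] := gs k; exists (m.+1 - j)%N; first exact: leq_subr.
  by rewrite gg' ?leq_subr // subKn.
have gm' k j : (k < j <= m.+1)%N -> - a (g' k) < - a (g' j).
  case/andP=> kj jm; rewrite ltrN2 !gg' //; last exact: leq_trans (ltnW kj) jm.
  by rewrite gm // leq_subr andbT; lia.
have L := outflow_budget iso_id e0 fe kh gs gm (leqW im) lefti.
have g'i : g' (m - i)%N = g i.+1.
  rewrite gg'; last lia.
  by congr g; lia.
have Rb : outflow -%R (fun p => - p <= - a (g i.+1)) (- a (g i.+1)) s sched <=
    budget a e g' (m - i).
  rewrite -g'i; apply: (outflow_budget iso_opp e0 fe kh gs' gm').
    exact: leqW (leq_subr _ _).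
  by rewrite subn_gt0 g'i lerN2.
set u := a (g i) in L *; set w := a (g i.+1) in Rb *.
have uw : u < w by rewrite gm // ltnSn.
have f0 := energy_after_ge0 (s := s) e0 fe.
have f : stock (fun p => p <= u) (after s sched) + stock (fun p => - p <= - w) (after s sched)
    <= stock predT (after s sched).
  rewrite /stock !(big_mkcond (fun k => _ _)) -big_split /=; apply: ler_sum => k _.
  have := f0 k; set p := pos _ k.
  by have [pu|up] := leP p u; have [pw|wp] := leP (- p) (- w); lra.
have t : stock predT s <= stock (fun p => p <= u) s + stock (fun p => - p <= - w) s.
  rewrite /stock !(big_mkcond (fun k => _ _)) -big_split /=; apply: ler_sum => k _.
  have [l lm <-] := gs k; have := e0 (g l).
  have [li|il] := leqP l i.
    have -> : a (g l) <= u.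
      by move: li; rewrite /u leq_eqVlt => /predU1P[->//|li]; rewrite ltW // gm // li leqW.
    by have [h1|h1] := leP (- a (g l)) (- w); lra.
  have -> : - a (g l) <= - w.
    by rewrite lerN2; move: il; rewrite leq_eqVlt => /predU1P[<-//|il]; rewrite ltW // gm // il.
  by have [h1|h1] := leP (a (g l)) u; lra.
(* [span] clips [X] to the segment. The first agent's information covers the part before [X], the
   last agent's the part after it. *)
have info_r : span u w X <= travel (up id u w) s sched.
  have : g 0%N \in known (after s sched) h by rewrite kh inE.
  rewrite -[leRHS]add0r; apply: (info_up (v := id) fe) => k; rewrite inE => /eqP <- /=.
  have gu : a (g 0%N) <= u by rewrite /u; case: (i) im => // i' i'm; rewrite ltW // gm //= leqW.
  by rewrite /span !min_l ?subrr // (le_trans gu) ?ltW.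
have info_l : w - u - span u w X <= travel (fun p x => up id u w x p) s sched.
  have : g m.+1 \in known (after s sched) h by rewrite kh inE.
  rewrite -(span_opp _ (ltW uw)).
  have -> : travel (fun p x => up id u w x p) s sched = travel (up -%R (- w) (- u)) s sched.
    apply/eqP; rewrite eq_le; apply/andP; split; apply: travel_le => p x;
    by rewrite /up !(span_opp _ (ltW uw)) le_eqVlt; apply/orP; left; apply/eqP; congr Num.max; ring.
  rewrite -[leRHS]add0r; apply: (info_up (v := -%R) fe) => k; rewrite inE => /eqP <- /=.
  have gw : w <= a (g m.+1).
    by rewrite /w; move: im; rewrite leq_eqVlt => /predU1P[-> //|im]; rewrite ltW // gm //= ltnS im /=.
  by rewrite /span !min_l ?subrr // lerN2 // (le_trans _ gw) ?ltW.
have tr : travel (fun p x => `|x - p|) s sched = travel (below id u) s sched +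
    travel (below -%R (- w)) s sched +
    (travel (up id u w) s sched + travel (fun p x => up id u w x p) s sched).
  rewrite -!travelD; apply/eqP; rewrite eq_le.
  by apply/andP; split; apply: travel_le => p x; rewrite (dist_split _ _ (ltW uw)).
rewrite ger0_norm ?subr_ge0 ?(ltW uw) //; apply: le_trans (_ : _ <= _) (lerD L Rb).
have := stock_total fe; rewrite tr /outflow /=; lra.
Qed.
End Flux.

Lemma split_distance (R : realType) (p q l : R) : 0 <= l -> l <= `|q - p| ->
  exists2 x, `|x - p| = l & `|q - x| = `|q - p| - l.
Proof.
move=> l0; have [pq|/ltW qp] := leP p q.
  rewrite ger0_norm ?subr_ge0 // => lq; exists (p + l); rewrite ger0_norm; lra.
rewrite ler0_norm ?subr_le0 // => lq; exists (p - l); rewrite ler0_norm; lra.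
Qed.

(** * Sufficiency *)

Section Reach.
Variables (R : realType) (n : nat).
Implicit Types (s : state R n).

Definition reach s s' : Prop :=
  exists2 sched, feasible s sched & foldl (@perform R n) s sched = s'.

Lemma reach_refl s : reach s s.
Proof. by exists [::]. Qed.

Lemma reach_trans s2 s1 s3 : reach s1 s2 -> reach s2 s3 -> reach s1 s3.
Proof.
move=> [c fc <-] [c' fc' <-]; exists (c ++ c'); last by rewrite foldl_cat.
by elim: c s1 fc fc' => //= m c IH s1 /andP[-> /IH].
Qed.

Lemma reach_step s m : enabled s m -> reach s (perform s m).
Proof. by move=> en; exists [:: m] => //=; rewrite en. Qed.

(** Frame condition, by which collections by disjoint groups compose. *)
Definition agree (A : pred 'I_n) s s' : Prop :=
  forall h, A h -> [/\ pos s' h = pos s h, energy s' h = energy s h & known s' h = known s h].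

Section Collect.
Variables (a e : 'I_n -> R) (g : nat -> 'I_n).
Notation d j := `|a (g j.+1) - a (g j)|.

(* The surplus [q] lets an outside agent lend what a negative budget lacks. *)
Lemma collect_budget i :
  (forall j k, (j <= i)%N -> (k <= i)%N -> g j = g k -> j = k) ->
  forall s q,
  (forall j, (j <= i)%N -> pos s (g j) = a (g j)) ->
  (forall j, (j < i)%N -> energy s (g j) = e (g j)) ->
  energy s (g i) = e (g i) + q -> 0 <= q -> 0 <= budget a e g i + q ->
  exists s',
    [/\ reach s s', pos s' (g i) = a (g i), energy s' (g i) = budget a e g i + q,
      (forall j, (j <= i)%N -> known s (g j) \subset known s' (g i)) &
      agree (fun h => [forall j : 'I_i.+1, h != g j]) s s'].
Proof.
elim: i => [|i IH] ginj s q ps es eq q0 bq.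
  by exists s; split; [exact: reach_refl | exact: ps | | case |].
have {}IH := IH (fun j k ji ki => ginj j k (leqW ji) (leqW ki)).
have psi j : (j <= i)%N -> pos s (g j) = a (g j) by move=> ji; rewrite ps // leqW.
have esi j : (j < i)%N -> energy s (g j) = e (g j) by move=> ji; rewrite es // leqW.
have gne j : (j <= i)%N -> g i.+1 != g j.
  move=> ji; apply/eqP => /(ginj _ _ (leqnn _) (leqW ji)) jE; move: ji; rewrite -jE ltnn; lia.
have gne' : g i != g i.+1 by rewrite eq_sym gne.
have gall : [forall j : 'I_i.+1, g i.+1 != g j].
  by apply/forallP => j; rewrite gne // -ltnS.
have agree_sub s1 s2 : agree (fun h => [forall j : 'I_i.+1, h != g j]) s s1 ->
  agree (fun h => [forall j : 'I_i.+2, h != g j]) s1 s2 ->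
  agree (fun h => [forall j : 'I_i.+2, h != g j]) s s2.
  move=> A1 A2 h hP; have [-> -> ->] := A2 h hP; apply: A1.
  by apply/forallP => j; have := forallP hP (widen_ord (leqnSn _) j).
have outer h : [forall j : 'I_i.+2, h != g j] -> (h == g i = false) * (h == g i.+1 = false).
  move=> /forallP hP; split; apply/negbTE.
    by have := hP (Ordinal (ltnW (ltnSn i.+1))).
  exact: (hP ord_max).
have bs : budget a e g i.+1 = cross (d i) (budget a e g i) + e (g i.+1) by [].
set L := budget a e g i in IH bs *; rewrite bs in bq *.
have d0 : 0 <= d i by [].
have P_x1 := ps _ (leqnn i.+1).
have ne01 : (g i == g i.+1) = false by apply/negbTE.
have ne10 : (g i.+1 == g i) = false by rewrite eq_sym.
have simp := (eqxx, ne01, ne10).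
have ei : energy s (g i) = e (g i) + 0 by rewrite addr0 es.
(* [g i] can reach the next agent and hands over what remains. *)
have [Ld|dL] := leP (d i) L.
  have L0 : 0 <= L + 0 by lra.
  have [s1 [r1 p1 e1 k1 A1]] := IH s 0 psi esi ei (lexx 0) L0.
  have [P1 E1 K1] := A1 _ gall.
  set m1 := Move (g i) (a (g i.+1)).
  have en1 : enabled s1 m1 by rewrite /= p1 e1 addr0.
  set m2 := Meet (g i) (g i.+1) (L - d i).
  have en2 : enabled (perform s1 m1) m2.
    by rewrite /= !simp P1 P_x1 eqxx /= e1 p1; lra.
  exists (perform (perform s1 m1) m2); split.
  - exact: reach_trans r1 (reach_trans (reach_step en1) (reach_step en2)).
  - by rewrite /= !simp P1 P_x1.
  - by rewrite /= !simp E1 eq /cross Ld; lra.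
  - move=> j; rewrite /= !simp leq_eqVlt => /predU1P[->|ji].
      by rewrite K1 subsetUr.
    exact: subset_trans (k1 j ji) (subsetUl _ _).
  - by apply: agree_sub A1 _ => h /outer oh /=; rewrite !oh.
(* [g i] spends all of [L] walking to [x]; [g i.+1] meets it there and returns, covering [d i - L]
   twice. *)
have [L0|L0] := leP 0 L.
  have L0' : 0 <= L + 0 by lra.
  have cE : cross (d i) L = 2 * (L - d i) by rewrite /cross leNgt dL L0.
  rewrite cE in bq *.
  have [s1 [r1 p1 e1 k1 A1]] := IH s 0 psi esi ei (lexx 0) L0'.
  have [P1 E1 K1] := A1 _ gall.
  have [x x0 x1] : exists2 x, `|x - a (g i)| = L & `|a (g i.+1) - x| = d i - L.
    exact: split_distance L0 (ltW dL).
  have x1' : `|x - a (g i.+1)| = d i - L by rewrite distrC.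
  set m1 := Move (g i) x; set m2 := Move (g i.+1) x.
  set m3 := Meet (g i) (g i.+1) (0 : R); set m4 := Move (g i.+1) (a (g i.+1)).
  have en1 : enabled s1 m1 by rewrite /= p1 e1 x0; lra.
  have en2 : enabled (perform s1 m1) m2.
    by rewrite /= !simp P1 P_x1 E1 eq x1'; lra.
  have en3 : enabled (perform (perform s1 m1) m2) m3.
    by rewrite /= !simp /= lexx e1 p1 x0; lra.
  have en4 : enabled (perform (perform (perform s1 m1) m2) m3) m4.
    by rewrite /= !simp P1 P_x1 E1 eq ?x1 x1'; lra.
  exists (perform (perform (perform (perform s1 m1) m2) m3) m4); split.
  - apply: reach_trans r1 (reach_trans (reach_step en1) (reach_trans (reach_step en2) _)).
    exact: reach_trans (reach_step en3) (reach_step en4).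
  - by rewrite /= !simp.
  - by rewrite /= !simp P1 P_x1 E1 eq ?x1 x1'; lra.
  - move=> j; rewrite /= !simp leq_eqVlt => /predU1P[->|ji].
      by rewrite K1 subsetUr.
    exact: subset_trans (k1 j ji) (subsetUl _ _).
  - by apply: agree_sub A1 _ => h /outer oh /=; rewrite !oh.
(* The deficit must be met before collecting: [g i.+1] walks to [g i], lends [- L] as the surplus of
   the recursive call, waits, and carries the information back. *)
have cE : cross (d i) L = L - 2 * d i by rewrite /cross leNgt dL leNgt L0.
rewrite cE in bq *.
set m1 := Move (g i.+1) (a (g i)); set m2 := Meet (g i.+1) (g i) (- L).
have en1 : enabled s m1 by rewrite /= P_x1 eq distrC; lra.
have en2 : enabled (perform s m1) m2.
  by rewrite /= !simp /= psi // eqxx /= P_x1 eq distrC; lra.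
set s2 := perform (perform s m1) m2.
have gneq j : (j <= i)%N -> (g j == g i.+1) = false.
  by move=> ji; rewrite eq_sym; apply/negbTE/gne.
have gneq' j : (j < i)%N -> (g j == g i) = false.
  by move=> ji; apply/negbTE/eqP => /ginj; lia.
have ps2 j : (j <= i)%N -> pos s2 (g j) = a (g j) by move=> ji /=; rewrite gneq // psi.
have es2 j : (j < i)%N -> energy s2 (g j) = e (g j).
  by move=> ji /=; rewrite gneq ?gneq' ?esi // ltnW.
have ei2 : energy s2 (g i) = e (g i) + - L by rewrite /= !simp es.
have [||s3 [r3 p3 e3 k3 A3]] := IH s2 (- L) ps2 es2 ei2; [lra|lra|].
have [P3 E3 K3] := A3 _ gall.
have {}P3 : pos s3 (g i.+1) = a (g i) by rewrite P3 /= !simp.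
have {}E3 : energy s3 (g i.+1) = e (g i.+1) + q - d i + L.
  by rewrite E3 /= !simp P_x1 eq distrC; lra.
set m3 := Meet (g i) (g i.+1) (0 : R); set m4 := Move (g i.+1) (a (g i.+1)).
have en3 : enabled s3 m3 by rewrite /= ne01 p3 P3 eqxx lexx e3 /=; lra.
have en4 : enabled (perform s3 m3) m4 by rewrite /= !simp P3 E3; lra.
exists (perform (perform s3 m3) m4); split.
- apply: reach_trans (reach_step en1) (reach_trans (reach_step en2) (reach_trans r3 _)).
  exact: reach_trans (reach_step en3) (reach_step en4).
- by rewrite /= !simp.
- by rewrite /= !simp P3 E3; lra.
- move=> j; rewrite /= !simp leq_eqVlt => /predU1P[->|ji].
    by rewrite K3 /= !simp subsetU // subsetUl orbT.
  rewrite subsetU // (subset_trans _ (k3 j ji)) //= gneq //.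
  by case: eqP => [->|_] //; rewrite subsetUr.
- move=> h oh; have /outer oh' := oh.
  have [|P E K] := A3 h; first by apply/forallP => j; have := forallP oh (widen_ord (leqnSn _) j).
  by rewrite /= !oh' P E K /= !oh'.
Qed.

End Collect.

(** * Joining the collections of the two sides *)

Section TwoSides.
Variables (a e : 'I_n -> R) (g g' : nat -> 'I_n) (i k : nat).
Hypothesis ginj : forall j l, (j <= i)%N -> (l <= i)%N -> g j = g l -> j = l.
Hypothesis ginj' : forall j l, (j <= k)%N -> (l <= k)%N -> g' j = g' l -> j = l.
Hypothesis gdisj : forall j l, (j <= i)%N -> (l <= k)%N -> g j != g' l.
Hypothesis gcover : forall h,
  (exists2 j, (j <= i)%N & h = g j) \/ (exists2 l, (l <= k)%N & h = g' l).

Lemma convergecast_two_sides :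
  0 <= budget a e g i ->
  `|a (g' k) - a (g i)| <= budget a e g i + budget a e g' k -> convergecast a e.
Proof.
set L := budget a e g i; set L' := budget a e g' k; set D := `|_| => L0 LD.
set s := initial_state a e.
have known_all s1 h : reach s s1 -> (forall h', h' \in known s1 h) -> convergecast a e.
  move=> [sched fe <-] kh; exists sched => //; exists h.
  by apply/setP => h'; rewrite [RHS]inE; apply: kh.
have [s1 [r1 p1 e1 k1 A1]] : exists s1,
    [/\ reach s s1, pos s1 (g i) = a (g i), energy s1 (g i) = L + 0,
      (forall j, (j <= i)%N -> known s (g j) \subset known s1 (g i)) &
      agree (fun h => [forall j : 'I_i.+1, h != g j]) s s1].
  by apply: (collect_budget (a := a) (e := e) ginj) => //=; rewrite addr0.
have D0 : 0 <= D by exact: normr_ge0.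
have out' l : (l <= k)%N -> [forall j : 'I_i.+1, g' l != g j].
  by move=> lk; apply/forallP => j; rewrite eq_sym gdisj // -ltnS.
have out j : (j <= i)%N -> [forall l : 'I_k.+1, g j != g' l].
  by move=> lk; apply/forallP => l; rewrite gdisj // -ltnS.
have ne : (g i == g' k) = false by apply/negbTE/gdisj.
have ne' : (g' k == g i) = false by rewrite eq_sym.
have simp := (eqxx, ne, ne').
have P1 l : (l <= k)%N -> pos s1 (g' l) = a (g' l) by case/out'/A1.
have E1 l : (l <= k)%N -> energy s1 (g' l) = e (g' l) by case/out'/A1.
have K1 l : (l <= k)%N -> known s1 (g' l) = [set g' l] by case/out'/A1.
have [L0'|L0'] := leP 0 L'.
  have [||||s2 [r2 p2 e2 k2 A2]] := collect_budget (a := a) (e := e) ginj' (s := s1) (q := 0) P1.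
  - by move=> l /ltnW /E1.
  - by rewrite E1 // addr0.
  - by [].
  - by rewrite addr0.
  have [P2 E2 K2] := A2 _ (out _ (leqnn i)).
  (* [l], the smaller of [L] and [D], is the share of the distance walked by [g i]; [g' k] walks the
     rest. *)
  have [l [l0 lL lD lL']] : exists l, [/\ 0 <= l, l <= L, l <= D & D - l <= L'].
    by have [h|/ltW h] := leP L D; [exists L | exists D]; split; lra.
  have [x x0 x1] := split_distance l0 lD.
  set m1 := Move (g i) x; set m2 := Move (g' k) x; set m3 := Meet (g i) (g' k) (0 : R).
  have en1 : enabled s2 m1 by rewrite /= P2 E2 p1 e1 x0; lra.
  have en2 : enabled (perform s2 m1) m2.
    by rewrite /= !simp p2 e2 distrC x1 -/D -/L'; lra.
  have en3 : enabled (perform (perform s2 m1) m2) m3.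
    by rewrite /= !simp /= lexx P2 E2 p1 e1 x0; lra.
  apply: (known_all (perform (perform (perform s2 m1) m2) m3) (g i)).
    apply: reach_trans r1 (reach_trans r2 (reach_trans (reach_step en1) _)).
    exact: reach_trans (reach_step en2) (reach_step en3).
  move=> h; rewrite /= !simp inE K2; apply/orP; have [[j ji ->]|[j jk ->]] := gcover h.
    by left; apply: (subsetP (k1 j ji)); rewrite inE.
  by right; apply: (subsetP (k2 j jk)); rewrite K1 // inE.
(* Here [L] covers the whole distance and the deficit [- L'], so [g i] delivers the loan and waits
   for the other side to collect. *)
set m1 := Move (g i) (a (g' k)); set m2 := Meet (g i) (g' k) (- L').
have en1 : enabled s1 m1 by rewrite /= p1 e1 -/D; lra.
have en2 : enabled (perform s1 m1) m2.
  by rewrite /= !simp /= P1 // eqxx /= p1 e1 -/D; lra.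
set s2 := perform (perform s1 m1) m2.
have gne l : (l <= k)%N -> (g' l == g i) = false.
  by move=> lk; rewrite eq_sym; apply/negbTE/gdisj.
have gne' l : (l < k)%N -> (g' l == g' k) = false.
  by move=> lk; apply/negbTE/eqP => /ginj'; lia.
have [|||||s3 [r3 p3 e3 k3 A3]] :=
    collect_budget (a := a) (e := e) ginj' (s := s2) (q := - L').
- by move=> l lk; rewrite /= gne // P1.
- by move=> l lk; rewrite /= gne ?gne' ?E1 // ltnW.
- by rewrite /= !simp E1.
- by lra.
- by rewrite -/L'; lra.
have [P3 E3 K3] := A3 _ (out _ (leqnn i)).
set m3 := Meet (g i) (g' k) (0 : R).
have en3 : enabled s3 m3.
  by rewrite /= ne P3 p3 /= !simp /= lexx E3 /= !simp p1 e1 -/D; lra.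
apply: (known_all (perform s3 m3) (g i)).
  apply: reach_trans r1 (reach_trans (reach_step en1) (reach_trans (reach_step en2) _)).
  exact: reach_trans r3 (reach_step en3).
move=> h; rewrite /= !simp inE K3 /= !simp inE.
have [[j ji ->]|[j jk ->]] := gcover h.
  by rewrite (subsetP (k1 j ji)) // inE.
rewrite (subsetP (k3 j jk)) ?orbT //= gne //.
by case: eqP => [->|_]; rewrite ?inE K1 ?inE ?eqxx ?orbT.
Qed.
End TwoSides.
End Reach.

(** The budgets sum to at least a distance, so one is nonnegative; exchanging the sides makes it the
    first. *)
Lemma convergecast_budgets (R : realType) (n : nat) (a e : 'I_n -> R)
    (g g' : nat -> 'I_n) (i k : nat) :
  (forall j l, (j <= i)%N -> (l <= i)%N -> g j = g l -> j = l) ->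
  (forall j l, (j <= k)%N -> (l <= k)%N -> g' j = g' l -> j = l) ->
  (forall j l, (j <= i)%N -> (l <= k)%N -> g j != g' l) ->
  (forall h, (exists2 j, (j <= i)%N & h = g j) \/ (exists2 l, (l <= k)%N & h = g' l)) ->
  `|a (g' k) - a (g i)| <= budget a e g i + budget a e g' k -> convergecast a e.
Proof.
move=> gi gi' gd gc le_d; have [L0|L0] := leP 0 (budget a e g i).
  exact: (convergecast_two_sides gi gi' gd gc).
apply: (convergecast_two_sides gi' gi).
- by move=> j l jk li; rewrite eq_sym gd.
- by move=> h; have [] := gc h; [right|left].
- by have := normr_ge0 (a (g' k) - a (g i)); lra.
- by rewrite distrC [leRHS]addrC.
Qed.

(** * The program *)

(* I[0] = n, I[1] = current agent, I[2] = 1, I[3] = address, I[4] = 2 n,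
   I[5] = 0; X[0] = 0, X[1] = current position, X[2] = current budget,
   X[4] = distance to the next agent.  The loop at 6 stores the budgets from
   the left in M[2n], ..., M[3n-1]; the loop at 27 goes back from the right. *)
Definition gathering_program : program :=
  [:: IdxConst 2 1; IdxAdd 4 0 0; JumpIdxLe 0 2 46;
      Fetch 1 1; Fetch 2 0; Store 4 2;
      (* 6 *)
      IdxAdd 1 1 2; JumpIdxLe 0 1 23;
      Fetch 6 1; RealOp Defs.Sub 4 6 1; RealOp Add 1 6 0;
      IdxAdd 3 1 0; Fetch 5 3;
      (* 13 *)
      RealOp Defs.Sub 3 2 4; JumpRealLe 4 2 19; JumpRealLe 0 2 18;
      RealOp Defs.Sub 3 3 4; Jump 19;
      (* 18 *)
      RealOp Add 3 3 3;
      (* 19 *)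
      RealOp Add 2 3 5; IdxAdd 3 1 4; Store 3 2; Jump 6;
      (* 23 *)
      IdxSub 1 1 2; Fetch 1 1; IdxAdd 3 1 0; Fetch 2 3;
      (* 27 *)
      JumpIdxLe 1 5 47; IdxSub 1 1 2;
      Fetch 6 1; RealOp Defs.Sub 4 1 6; RealOp Add 1 6 0;
      IdxAdd 3 1 4; Fetch 5 3; RealOp Add 5 5 2; JumpRealLe 4 5 46;
      IdxAdd 3 1 0; Fetch 5 3;
      (* 38 *)
      RealOp Defs.Sub 3 2 4; JumpRealLe 4 2 44; JumpRealLe 0 2 43;
      RealOp Defs.Sub 3 3 4; Jump 44;
      (* 43 *)
      RealOp Add 3 3 3;
      (* 44 *)
      RealOp Add 2 3 5; Jump 27;
      (* 46 *)
      Halt true; Halt false].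

(** * Composing bounded executions *)

Section Run.
Variable R : realType.
Implicit Types (p : program) (s : machine R).

(** Exactly [k] instructions without halting, so that pieces of code compose by adding step
    counts. *)
Fixpoint advance p k s : option (machine R) :=
  if k is k'.+1 then
    if onth p (pc s) is Some c then
      if exec s c is inl s' then advance p k' s' else None
    else None
  else Some s.

Lemma advanceS p k c s s1 r : onth p (pc s) = Some c -> exec s c = inl s1 ->
  advance p k s1 = r -> advance p k.+1 s = r.
Proof. by move=> /= -> -> ->. Qed.

Lemma advanceD p k1 k2 s s' :
  advance p k1 s = Some s' -> advance p (k1 + k2) s = advance p k2 s'.
Proof.
elim: k1 s => [|k1 IH] s /=; first by case=> ->.
by case: onth => // c; case: exec => // s1 /IH.
Qed.

Lemma run_advance p k t s s' :
  advance p k s = Some s' -> run p (k + t) s = run p t s'.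
Proof.
elim: k s => [|k IH] s /=; first by case=> ->.
by case: onth => // c; case: exec => // s1 /IH.
Qed.

Lemma run_mono p t t' s b : (t <= t')%N -> run p t s = Some b -> run p t' s = Some b.
Proof.
elim: t t' s => // t IH [|t'] s //= tt'; case: onth => // c.
by case: exec => // s1; apply: IH.
Qed.
End Run.

Arguments advance : simpl never.

(* Executing one instruction at a time keeps the conversions checked at [Qed]
   small. *)
Ltac steps simp :=
  repeat (apply: advanceS; [by [] | by rewrite /= ?simp /=; reflexivity |]);
  by reflexivity.

(** * Correctness and running time of the program *)

Section Correctness.
Variables (R : realType) (m : nat) (a e : 'I_m.+1 -> R).
Hypothesis a_mono : forall i j : 'I_m.+1, (i < j)%N -> a i < a j.
Notation n := m.+1.
Notation p := gathering_program.

Definition from_left j : 'I_n := inord j.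
Definition from_right j : 'I_n := inord (m - j).
Notation L := (budget a e from_left).
Notation L' := (budget a e from_right).

Definition stores_instance (M : nat -> R) :=
  forall k, (k < n)%N -> M k = a (inord k) /\ M (n + k)%N = e (inord k).

Definition loop_state s q i (x y : R) (M : nat -> R) :=
  [/\ pc s = q, [/\ idx s 0 = n, idx s 1 = i, idx s 2 = 1, idx s 4 = (n + n)%N & idx s 5 = 0]%N,
    [/\ reg s 0%N = 0, reg s 1%N = x & reg s 2%N = y] & Defs.mem s = M].

(** Both passes contain the same code for one budget step, up to jump targets; the three branches
    take 3, 5 and 6 instructions. *)
Lemma cross_block q (s : machine R) (x y d z : R) : q \in [:: 13; 38]%N -> pc s = q ->
  [/\ reg s 0%N = 0, reg s 1%N = x, reg s 2%N = y, reg s 4%N = d & reg s 5%N = z] ->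
  exists k s', [/\ (k <= 6)%N, advance p k s = Some s',
    pc s' = (q + 7)%N /\ idx s' = idx s, Defs.mem s' = Defs.mem s &
    [/\ reg s' 0%N = 0, reg s' 1%N = x & reg s' 2%N = cross d y + z]].
Proof.
case: s => q' ix rg M; rewrite !inE => qE /= -> [r0 r1 r2 r4 r5].
have simp := (r0, r1, r2, r4, r5); rewrite /cross.
case dL : (d <= y); last case L0 : (0 <= y).
- by exists 3%N; case/orP: qE => /eqP ->; eexists; (split; [by []|by steps (simp, dL)|..]) => //=; rewrite ?simp.
- exists 5%N; case/orP: qE => /eqP ->; eexists; (split; [by []|by steps (simp, dL, L0)|..]) => //=;
  by rewrite ?simp mulr_natl mulr2n.
- have -> : y - 2 * d = y - d - d by ring.
  by exists 6%N; case/orP: qE => /eqP ->; eexists; (split; [by []|by steps (simp, dL, L0)|..]) => //=; rewrite ?simp.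
Qed.

Lemma left_step i s M : (i < m)%N -> stores_instance M ->
  loop_state s 6 i (a (from_left i)) (L i) M ->
  exists k s', [/\ (k <= 16)%N, advance p k s = Some s' &
    loop_state s' 6 i.+1 (a (from_left i.+1)) (L i.+1)
      [eta M with (n + n + i.+1)%N |-> L i.+1]].
Proof.
case: s => q ix rg mm im Mi; rewrite /loop_state /=.
case=> -> [i0 i1 i2 i4 i5] [r0 r1 r2] ->.
have [Ma Me] : M i.+1 = a (from_left i.+1) /\ M (i.+1 + n)%N = e (from_left i.+1).
  by rewrite addnC; apply: Mi.
have d : a (from_left i.+1) - a (from_left i) = `|a (from_left i.+1) - a (from_left i)|.
  by rewrite ger0_norm // subr_ge0 ltW // a_mono // !inordK // ltnW.
move: d; set D := `|_| => d.
have nle : (n <= i.+1)%N = false by apply/negbTE; rewrite -ltnNge.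
have simp := (i0, i1, i2, i4, i5, r0, r1, r2, addn1 i, nle, Ma, Me, d).
have [s1 [ad1 s1E M1 s1r]] : exists s1, [/\ advance p 7 (Machine 6 ix rg M) = Some s1,
    [/\ pc s1 = 13, idx s1 0 = n, idx s1 1 = i.+1, idx s1 2 = 1 & idx s1 4 = n + n /\ idx s1 5 = 0]%N,
    Defs.mem s1 = M &
    [/\ reg s1 0%N = 0, reg s1 1%N = a (from_left i.+1), reg s1 2%N = L i, reg s1 4%N = D &
      reg s1 5%N = e (from_left i.+1)]].
  by eexists; split; [steps simp|..] => //=; rewrite ?simp ?addr0.
case: s1E => pc1 i10 i11 i12 [i14 i15].
have [k [s2 [k6 ad2 [pc2 I2] M2 [r20 r21 r22]]]] := cross_block (q := 13) isT pc1 s1r.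
case: s2 pc2 I2 M2 r20 r21 r22 ad2 => q2 ix2 rg2 mm2 /= -> -> -> r20 r21 r22 ad2.
exists (7 + (k + 3))%N; rewrite (advanceD _ ad1) (advanceD _ ad2) M1; eexists; split; first by lia.
  by steps (i10, i11, i14, r22).
by rewrite /= ?r20 ?r21 ?r22 ?i10 ?i11 ?i14 [(i.+1 + _)%N]addnC; split.
Qed.

Lemma left_loop r i s M : (i + r)%N = m -> stores_instance M ->
  (forall j, (j <= i)%N -> M (n + n + j)%N = L j) ->
  loop_state s 6 i (a (from_left i)) (L i) M ->
  exists k s' M', [/\ (k <= 16 * r)%N, advance p k s = Some s', stores_instance M',
    forall j, (j <= m)%N -> M' (n + n + j)%N = L j &
    loop_state s' 6 m (a (from_left m)) (L m) M'].
Proof.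
elim: r i s M => [|r IH] i s M; first by rewrite addn0 => ->; exists 0%N, s, M.
move=> ir Mi ML /left_step -/(_ _ Mi) [|k [s1 [k16 ad1 l1]]]; first by rewrite -ir -addSnnS leq_addr.
have [|||k2 [s2 [M2 [k2r ad2 M2i M2L l2]]]] := IH _ _ _ _ _ _ l1.
- by rewrite addSnnS.
(* Budgets are stored from address [n + n] on, beyond the instance. *)
- move=> j jn /=; do 2 (case: eqP => [|_]; first by lia); exact: Mi.
- move=> j; rewrite leq_eqVlt => /predU1P[->|ji] /=; first by rewrite eqxx.
  by case: eqP => [|_]; [lia | apply: ML].
exists (k + k2)%N, s2, M2; split => //; first by rewrite mulnS leq_add.
by rewrite (advanceD _ ad1).
Qed.

Notation gap k := `|a (from_right k.+1) - a (from_right k)|.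
(** The criterion on the segment between agents [m - k.+1] and [m - k], in the order of the backward
    pass. *)
Definition meets k := gap k <= L (m - k.+1) + L' k.

Lemma right_step k s M : (k < m)%N -> stores_instance M ->
  (forall j, (j <= m)%N -> M (n + n + j)%N = L j) ->
  loop_state s 27 (m - k) (a (from_right k)) (L' k) M ->
  if meets k then run p 10 s = Some true else
  exists l s', [/\ (l <= 18)%N, advance p l s = Some s' &
    loop_state s' 27 (m - k.+1) (a (from_right k.+1)) (L' k.+1) M].
Proof.
case: s => q ix rg mm km Mi ML; rewrite /loop_state /=.
case=> -> [i0 i1 i2 i4 i5] [r0 r1 r2] ->.
have iE : (m - k - 1)%N = (m - k.+1)%N by rewrite subn1 subnS.
have im : (m - k.+1 < n)%N by rewrite ltnS leq_subr.
have [Ma Me] : M (m - k.+1)%N = a (from_right k.+1) /\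
    M (m - k.+1 + n)%N = e (from_right k.+1) by rewrite addnC; apply: Mi.
have Ml : M (m - k.+1 + (n + n))%N = L (m - k.+1) by rewrite addnC ML ?leq_subr.
have d : a (from_right k) - a (from_right k.+1) = gap k.
  rewrite ltr0_norm ?opprB // subr_lt0 a_mono // !inordK ?ltnS ?leq_subr //; lia.
rewrite /meets; move: d; set D := `|_| => d.
have nle : (m - k <= 0)%N = false by lia.
have simp := (i0, i1, i2, i4, i5, r0, r1, r2, iE, nle, Ma, Me, Ml, d).
have [s1 [ad1 s1E M1 s1r]] : exists s1, [/\ advance p 8 (Machine 27 ix rg M) = Some s1,
    [/\ pc s1 = 35, idx s1 0 = n, idx s1 1 = m - k.+1, idx s1 2 = 1 & idx s1 4 = n + n /\ idx s1 5 = 0]%N,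
    Defs.mem s1 = M &
    [/\ reg s1 0%N = 0, reg s1 1%N = a (from_right k.+1), reg s1 2%N = L' k, reg s1 4%N = D &
      reg s1 5%N = L (m - k.+1) + L' k]].
  by eexists; split; [steps simp|..] => //=; rewrite ?simp ?addr0.
case: s1 ad1 s1E M1 s1r => q1 ix1 rg1 mm1 ad1 /= [q1E i10 i11 i12 [i14 i15]] mm1E.
rewrite q1E mm1E in ad1 => -[r10 r11 r12 r14 r15].
case mt : (D <= L (m - k.+1) + L' k).
  (* The two instructions are the successful comparison and [Halt]. *)
  by apply: (etrans (run_advance 2 ad1)); rewrite /= r14 r15 mt.
have [s2 [ad2 s2E M2 s2r]] : exists s2, [/\ advance p 3 (Machine 35 ix1 rg1 M) = Some s2,
    pc s2 = 38%N /\ idx s2 = [eta ix1 with 3%N |-> (m - k.+1 + n)%N], Defs.mem s2 = M &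
    [/\ reg s2 0%N = 0, reg s2 1%N = a (from_right k.+1), reg s2 2%N = L' k, reg s2 4%N = D &
      reg s2 5%N = e (from_right k.+1)]].
  by eexists; split; [steps (i10, i11, r14, r15, mt)|..] => //=; rewrite ?Me.
have [l [s3 [l6 ad3 [pc3 I3] M3 [r30 r31 r32]]]] := cross_block (q := 38) isT s2E.1 s2r.
exists (8 + (3 + (l + 1)))%N, (goto s3 27); rewrite (advanceD _ ad1) (advanceD _ ad2) (advanceD _ ad3).
split; [by lia | by rewrite /advance /= pc3 | rewrite /= I3 s2E.2 M3 M2 r30 r31 r32; split=> //].
Qed.

(** Failing rounds take at most 18 instructions each; the last 10 suffice for a successful round or
    for the exit with [Halt false]. *)
Lemma right_loop r k s M : (k + r)%N = m -> stores_instance M ->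
  (forall j, (j <= m)%N -> M (n + n + j)%N = L j) ->
  loop_state s 27 (m - k) (a (from_right k)) (L' k) M ->
  run p (18 * r + 10) s = Some (has meets (iota k r)).
Proof.
move=> + Mi ML; elim: r k s => [|r IH] k s.
  rewrite addn0 muln0 add0n => ->; rewrite subnn; case: s => q ix rg mm.
  by rewrite /loop_state /= => -[-> [_ i1 _ _ i5] _ _]; rewrite /= i1 i5.
move=> kr ls; have km : (k < m)%N by rewrite -kr -addSnnS leq_addr.
have := right_step km Mi ML ls; rewrite [has _ _]/=; case: ifP => [_ r10|_ [l [s' [l18 ad ls']]]].
  by apply: run_mono r10; rewrite leq_addl.
apply: (@run_mono _ _ (l + (18 * r + 10))); first by rewrite mulnS; lia.
by rewrite (run_advance _ ad); apply: IH ls'; rewrite addSnnS.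
Qed.

Lemma gathering_program_runs :
  run p (60 * n) (instance_machine a e) = Some ((m == 0%N) || has meets (iota 0 m)).
Proof.
set M0 := nth 0 (codom a ++ codom e).
have nth_codom (f : 'I_n -> R) (j : nat) : (j < n)%N -> nth 0 (codom f) j = f (inord j).
  move=> jn; rewrite -[in LHS](inordK jn) codomE (nth_map ord0) ?nth_ord_enum //.
  by rewrite size_enum_ord.
have M0i : stores_instance M0.
  move=> j jn; rewrite /M0 !nth_cat size_codom card_ord jn.
  by rewrite ltnNge leq_addr /= addKn !nth_codom.
have [m0|m0] := posnP m.
  (* With one agent, the initial test jumps to [Halt true] at once. *)
  apply: (@run_mono _ _ 4); first by lia.
  have m1 : (m < 1)%N by rewrite m0.
  by rewrite /instance_machine /start_machine /= m1.
rewrite orFb.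
have [s1 [ad1 ls1]] : exists s1, advance p 6 (instance_machine a e) = Some s1 /\
    loop_state s1 6 0 (a (from_left 0)) (L 0) [eta M0 with (n + n + 0)%N |-> L 0].
  have nle : (n <= 1)%N = false by apply/negbTE; rewrite -ltnNge.
  have [Ma Me] := M0i 0%N isT; rewrite addn0 in Me.
  eexists; split; first by steps nle.
  by rewrite /loop_state /= -/M0 Ma Me addn0; split.
have [||k [s2 [M [km ad2 Mi ML ls2]]]] := left_loop (add0n m) _ _ ls1.
- by move=> j jn /=; do 2 (case: eqP => [|_]; first by lia); exact: M0i.
- by move=> j; rewrite leqn0 => /eqP ->; rewrite /= eqxx.
have [s3 [ad3 ls3]] : exists s3, advance p 6 s2 = Some s3 /\
    loop_state s3 27 (m - 0) (a (from_right 0)) (L' 0) M.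
  case: s2 {ad2} ls2 => q ix rg mm; rewrite /loop_state /=.
  case=> -> [i0 i1 i2 i4 i5] [r0 r1 r2] ->.
  have [Ma Me] : M m = a (from_right 0) /\ M (m + n)%N = e (from_right 0).
    by rewrite addnC /from_right subn0; apply: Mi.
  have simp := (i0, i1, i2, i4, i5, r0, r1, r2, addn1 m, subn1 n, leqnn n, Ma, Me).
  eexists; split; first by steps simp.
  by rewrite /= ?simp subn0; split.
(* Since [k] is at most [16 * m], the total is at most [34 * m + 22], within [60 * n]. *)
apply: (@run_mono _ _ (6 + (k + (6 + (18 * m + 10))))); first by lia.
rewrite (run_advance _ ad1) (run_advance _ ad2) (run_advance _ ad3).
exact: right_loop (add0n m) Mi ML ls3.
Qed.
End Correctness.

Theorem theorem2 (R : realType) :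
  exists (p : program) (c : nat),
    forall (n : nat) (a e : 'I_n -> R),
      (0 < n)%N ->
      (forall i j : 'I_n, (i < j)%N -> a i < a j) ->
      (forall i : 'I_n, 0 <= e i) ->
      exists2 b : bool,
        run p (c * n) (instance_machine a e) = Some b &
        (b <-> convergecast a e).
Proof.
exists gathering_program, 60%N => -[//|m] a e _ a_mono e0.
exists ((m == 0%N) || has (meets a e) (iota 0 m)).
  exact: gathering_program_runs.
case: m a e a_mono e0 => [|m] a e a_mono e0.
  split=> // _; exists [::] => //; exists ord0.
  by apply/setP => i; rewrite !inE !ord1.
have lr j : (j <= m.+1)%N -> from_right m.+1 j = from_left m.+1 (m.+1 - j) by [].
have li j l : (j <= m.+1)%N -> (l <= m.+1)%N -> from_left m.+1 j = from_left m.+1 l -> j = l.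
  by move=> jm lm /(congr1 val); rewrite /= !inordK.
rewrite orFb; split.
  case/hasP => k; rewrite mem_iota add0n => /andP[_ km]; rewrite /meets => gap_k.
  have lE : from_right m.+1 k.+1 = from_left m.+1 (m.+1 - k.+1) by [].
  apply: (@convergecast_budgets _ _ _ _ (from_left m.+1) (from_right m.+1) (m.+1 - k.+1) k).
  - by move=> j l jm lm; apply: li; lia.
  - by move=> j l jm lm; rewrite !lr; [move/li; lia|lia|lia].
  - by move=> j l jm lm; apply/eqP; rewrite lr; [move/li; lia|lia].
  - move=> h; have [hk|kh] := leqP h (m.+1 - k.+1); [left|right].
      by exists h => //; rewrite /from_left inord_val.
    have hm := ltn_ord h; exists (m.+1 - h)%N; first by lia.
    by rewrite /from_right subKn ?inord_val.
  - by rewrite -lE distrC.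
move=> /(@convergecast_gathers _ _ m _ _ (from_left m.+1) (from_right m.+1)) [|||//|i im gap_i].
- by move=> h; exists h; [have := ltn_ord h | rewrite /from_left inord_val].
- by [].
- by move=> i j /andP[ij jm]; apply: a_mono; rewrite !inordK //; lia.
(* Segment [i] counted from the left is segment [m - i] counted from the right. *)
apply/hasP; exists (m - i)%N; first by rewrite mem_iota; lia.
rewrite /meets distrC.
have -> : (m.+1 - (m - i).+1)%N = i by lia.
have -> : from_right m.+1 (m - i) = from_left m.+1 i.+1 by congr inord; lia.
by have -> : from_right m.+1 (m - i).+1 = from_left m.+1 i by congr inord; lia.
Qed.
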